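(* Let $R$ be a ring with identity and let $U_R$ be a finitely generated uniserial right $R$-module. If $\mathrm{Add}(U)$ is a covering class, then $\mathrm{Add}(U)$ is closed under direct limits.
   Context: A module is uniserial if its lattice of submodules is linearly ordered by inclusion. $\mathrm{Add}(U)$ denotes the class of all right $R$-modules isomorphic to a direct summand of a direct sum $U^{(X)}$ of copies of $U$, $X$ any set. An $\mathrm{Add}(U)$-precover of a right $R$-module $A$ is a homomorphism $f\colon C\to A$ with $C\in\mathrm{Add}(U)$ such that every homomorphism $C'\to A$ with $C'\in\mathrm{Add}(U)$ factors through $f$; it is an $\mathrm{Add}(U)$-cover if moreover every endomorphism $h$ of $C$ with $fh=f$ is an automorphism. $\mathrm{Add}(U)$ is covering if every right $R$-module has an $\mathrm{Add}(U)$-cover. Closed under direct limits means that the direct limit of any directed system of modules in $\mathrm{Add}(U)$ belongs to $\mathrm{Add}(U)$. *)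

(* Defs.v *)
From HB Require Import structures.
From mathcomp Require Import all_boot all_order all_algebra.
From mathcomp Require Import boolp classical_sets functions cardinality.

Set Implicit Arguments.
Unset Strict Implicit.
Unset Printing Implicit Defensive.

Import Order.TTheory GRing.Theory.
Local Open Scope ring_scope.

(* Right R-modules are left modules over the converse ring R^c, so that
   a *: u stands for u a and {linear M -> N} for right R-homomorphisms. *)
Notation rmodType R := (lmodType R^c).

Section Submodules.
Variable (R : pzRingType).

(* Boolean membership is no restriction on the submodules: boolp makes every
   proposition decidable. *)
Definition uniserial (M : rmodType R) : Prop :=
  forall A B : {pred M}, submod_closed A -> submod_closed B ->
    {subset A <= B} \/ {subset B <= A}.

Definition finitely_generated (M : rmodType R) : Prop :=
  exists (n : nat) (g : 'I_n -> M),
    forall m : M, exists a : 'I_n -> R^c, m = \sum_(i < n) a i *: g i.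

Definition direct_summand (M : rmodType R) (A : {pred M}) : Prop :=
  submod_closed A /\
  exists B : {pred M},
    [/\ submod_closed B,
        forall m, m \in A -> m \in B -> m = 0 &
        forall m, exists a b, [/\ a \in A, b \in B & m = a + b]].

Definition isomorphic_to_submodule (N M : rmodType R) (A : {pred M}) : Prop :=
  exists f : {linear N -> M},
    injective f /\ forall m, m \in A <-> exists n, f n = m.

End Submodules.

(* The direct sum U^(X) of copies of U indexed by X: the finitely supported
   functions X -> U with pointwise operations. *)
Section Copower.
Variables (R : pzRingType) (X : Type) (U : rmodType R).

Definition finsupp_fun : {pred X -> U} :=
  fun f => `[< finite_set [set x | f x != 0] >].

Lemma finsupp_fun_submod : submod_closed finsupp_fun.
Proof.
split=> [|a f g /asboolP fin_f /asboolP fin_g]; apply/asboolP.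
  by apply: sub_finite_set (finite_set0 X) => x /=; rewrite eqxx.
have fin_fg : finite_set (setU [set x | f x != 0] [set x | g x != 0]).
  by rewrite finite_setU.
apply: sub_finite_set fin_fg => x /= fgx_neq0.
have [fx0|] := eqVneq (f x) 0; last by left.
right; apply: contraNneq fgx_neq0 => gx0.
by rewrite -[(a *: f + g) x]/(a *: f x + g x) fx0 gx0 scaler0 addr0.
Qed.

HB.instance Definition _ :=
  GRing.isSubmodClosed.Build R^c (X -> U) finsupp_fun finsupp_fun_submod.

Record copower := Copower {
  copower_val :> X -> U;
  copower_valP : copower_val \in finsupp_fun }.

HB.instance Definition _ := [isSub for copower_val].
HB.instance Definition _ := [Choice of copower by <:].
HB.instance Definition _ := [SubChoice_isSubLmodule of copower by <:].

End Copower.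

Definition Add (R : pzRingType) (U M : rmodType R) : Prop :=
  exists (X : Type) (A : {pred copower X U}),
    direct_summand A /\ isomorphic_to_submodule M A.

Section Covers.
Variables (R : pzRingType) (K : rmodType R -> Prop).

Definition is_precover (C A : rmodType R) (f : {linear C -> A}) : Prop :=
  K C /\
  forall (C' : rmodType R) (g : {linear C' -> A}), K C' ->
    exists h : {linear C' -> C}, f \o h =1 g.

Definition is_cover (C A : rmodType R) (f : {linear C -> A}) : Prop :=
  is_precover f /\
  forall h : {linear C -> C}, f \o h =1 f -> bijective h.

Definition covering : Prop :=
  forall A : rmodType R,
    exists (C : rmodType R) (f : {linear C -> A}), is_cover f.

End Covers.

Section DirectLimits.
Variable (R : pzRingType).

Definition directed (d : Order.disp_t) (I : preorderType d) : Prop :=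
  inhabited I /\ forall i j : I, exists k : I, (i <= k)%O /\ (j <= k)%O.

Section System.
Variables (d : Order.disp_t) (I : preorderType d) (M : I -> rmodType R).
Variable (f : forall i j : I, (i <= j)%O -> {linear M i -> M j}).

Definition is_system : Prop :=
  (forall (i : I) (ii : (i <= i)%O), f ii =1 id) /\
  (forall (i j k : I) (ij : (i <= j)%O) (jk : (j <= k)%O) (ik : (i <= k)%O),
     f jk \o f ij =1 f ik).

Definition is_cocone (L : rmodType R) (l : forall i, {linear M i -> L}) : Prop :=
  forall (i j : I) (ij : (i <= j)%O), l j \o f ij =1 l i.

Definition is_direct_limit (L : rmodType R) (l : forall i, {linear M i -> L})
    : Prop :=
  is_cocone l /\
  forall (N : rmodType R) (g : forall i, {linear M i -> N}), is_cocone g ->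
    exists h : {linear L -> N},
      (forall i, h \o l i =1 g i) /\
      (forall h' : {linear L -> N}, (forall i, h' \o l i =1 g i) -> h' =1 h).

End System.

Definition closed_under_direct_limits (K : rmodType R -> Prop) : Prop :=
  forall (d : Order.disp_t) (I : preorderType d) (M : I -> rmodType R)
         (f : forall i j : I, (i <= j)%O -> {linear M i -> M j})
         (L : rmodType R) (l : forall i, {linear M i -> L}),
    directed I -> is_system f -> (forall i, K (M i)) ->
    is_direct_limit f l -> K L.

End DirectLimits.

(* Main.v *)
Require Import Defs.
From HB Require Import structures.
From mathcomp Require Import all_boot all_order all_algebra.
From mathcomp Require Import finmap generic_quotient.
From mathcomp Require Import boolp classical_sets functions cardinality fsbigop.

Set Implicit Arguments.
Unset Strict Implicit.
Unset Printing Implicit Defensive.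

Import GRing.Theory.
Local Open Scope classical_set_scope.
Local Open Scope ring_scope.

(** Let U be generated by u, and assume U nonzero. Uniseriality makes
    N = {x | u is not a multiple of x} the largest proper submodule, S = U / N
    is simple, and every homomorphism U -> S vanishes on N. The covers of S and
    of the countable power S^(nat) already decide the matter.

    - A surjective endomorphism g of U is injective
      (surjective_endo_injective). As ker g lies in N, every map U -> S factors
      through g. If p : C -> S is a cover, with C a summand of some U^(X), then
      p = p h for an endomorphism h of C that applies g to each coordinate and
      so kills every element with coordinates in ker g. If ker g <> 0, such
      elements form an essential submodule of U^(X); h being invertible, C = 0
      and hence S = 0. Thus an endomorphism whose image is not inside N is
      invertible, so End(U) is local.

    - The endomorphisms with image in N form a T-nilpotent ideal
      (radical_endos_nilpotent). Let p0 : C0 -> S be a cover and q_n a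
      sequence of endomorphisms of C0 with p0 q_n = 0. The countable power of p0
      is again a cover, so 1 - shift, where the shift applies q_n from copy n to
      copy n + 1, is invertible on C0^(nat). A preimage of an element c of
      copy 0 has coordinates c, q_0 c, q_1 q_0 c, and so on; one of them vanishes
      because the support is finite (cover_kernel_nilpotent). The
      canonical map U -> S lifts to a split monomorphism U -> C0, through which
      this applies to the endomorphisms of U with image in N.

    - A finitely generated module with such an endomorphism ring has Add(U)
      closed under direct limits (limit_in_Add). This is the theorem that flat
      modules over a perfect ring are projective, in the local case: among the
      maps U -> L into a direct limit L of modules of Add(U) that factor through
      some stage of the system, choose a basis Y modulo the radical. The map
      U^(Y) -> L is onto by T-nilpotency, and it is injective because finitely
      many members of Y lift to a common stage, where Gaussian elimination over
      the local ring End(U) applies. *)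

(** * Linear maps, quotients and products *)

Lemma inj_surj_bijective (S T : Type) (f : S -> T) :
  injective f -> (forall y, exists x, f x = y) -> bijective f.
Proof. by move=> f_inj /choice[g gK]; exists g => // x; apply: f_inj. Qed.

Section Modules.
Variable A : pzRingType.
Implicit Types V W M : lmodType A.

Definition linear_map V W (f : V -> W) (lin_f : linear f) : {linear V -> W} :=
  HB.pack f (GRing.isLinear.Build A V W _ f lin_f).

Lemma linear_sub_comp V W M (f : {linear V -> M}) (g : {linear V -> W})
    (h : {linear W -> M}) : linear (fun x => f x - h (g x)).
Proof.
move=> a x y; rewrite (linearP f) (linearP g) (linearP h) scalerBr opprD.
exact: addrACA.
Qed.

Lemma sum_of_linear n V W (f : 'I_n -> {linear V -> W}) :
  linear (fun x => \sum_i f i x).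
Proof.
move=> a x y; rewrite scaler_sumr -big_split; apply: eq_bigr => i _.
exact: linearP.
Qed.

Lemma factor_surjective V W M (g : {linear V -> W}) (f : {linear V -> M}) :
    (forall y, exists x, g x = y) -> (forall x, g x = 0 -> f x = 0) ->
  exists h : {linear W -> M}, forall x, h (g x) = f x.
Proof.
move=> /choice[s gs] ker_gf.
have fs x : f (s (g x)) = f x.
  by apply/eqP; rewrite -subr_eq0 -linearB ker_gf// linearB gs subrr.
suff lin : linear (f \o s) by exists (linear_map lin).
by move=> a x y /=; rewrite -(linearP f) -[RHS]fs (linearP g) !gs.
Qed.

Lemma linear_inverse V W (f : {linear V -> W}) : bijective f ->
  exists g : {linear W -> V}, cancel f g /\ cancel g f.
Proof.
move=> f_bij; have [f' f'K fK] := f_bij.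
have [|x fx0|g gf] := @factor_surjective V W V f idfun.
- by move=> y; exists (f' y).
- by apply: (can_inj f'K); rewrite linear0.
exists g; split=> [x|y]; first exact: gf.
by rewrite -[y]fK; congr (f _); exact: gf.
Qed.

Section Quotient.
Variables (V : lmodType A) (W : {pred V}).
Hypothesis W_closed : submod_closed W.

#[local] HB.instance Definition _ :=
  GRing.isSubmodClosed.Build A V W W_closed.

Local Notation Q := (Quotient.quot W).
Local Open Scope quotient_scope.

(* Locked because rewriting with pi_scale would otherwise look through the
   definition of scaleq and rewrite its own right-hand sides. *)
Let scaleq (a : A) (q : Q) : Q := locked (\pi_Q (a *: repr q)).

Let pi_scale a x : scaleq a (\pi_Q x) = \pi_Q (a *: x).
Proof.
rewrite /scaleq -lock; apply/eqP; rewrite -Quotient.idealrBE -scalerBr rpredZ//.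
by rewrite Quotient.idealrBE reprK.
Qed.

Let scaleqA a b q : scaleq a (scaleq b q) = scaleq (a * b) q.
Proof. by rewrite -[q]reprK !pi_scale scalerA. Qed.

Let scale1q : left_id 1 scaleq.
Proof. by move=> q; rewrite -[q]reprK pi_scale scale1r. Qed.

Let scaleqDr : right_distributive scaleq +%R.
Proof.
move=> a p q; rewrite -[p]reprK -[q]reprK !pi_scale.
by rewrite -!pi_addr pi_scale scalerDr.
Qed.

Let scaleqDl q : {morph scaleq^~ q : a b / a + b}.
Proof. by move=> a b; rewrite -[q]reprK !pi_scale scalerDl pi_addr. Qed.

#[local] HB.instance Definition _ := GRing.Zmodule_isLmodule.Build A Q
  scaleqA scale1q scaleqDr scaleqDl.

Lemma quotient_module : exists (Q : lmodType A) (c : {linear V -> Q}),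
  (forall y, exists x, c x = y) /\ (forall x, c x = 0 <-> x \in W).
Proof.
have lin : linear (\pi_Q : V -> Q).
  move=> a x y; rewrite pi_addr; congr (_ + _); exact/esym/pi_scale.
exists Q, (linear_map lin); split=> [y|x]; first by exists (repr y); exact: reprK.
have -> : (x \in W) = (linear_map lin x == 0).
  rewrite -[x in LHS]subr0 Quotient.idealrBE -[RHS]/(\pi_Q x == 0).
  by rewrite -[X in _ = (_ == X)]pi_zeror.
by split=> /eqP.
Qed.

End Quotient.

Definition product (I : Type) (M : I -> lmodType A) := forall i, M i.

Section Product.
Variables (I : Type) (M : I -> lmodType A).
Local Notation P := (product M).

HB.instance Definition _ := Choice.copy P (forall i, M i).

Let zero : P := fun=> 0.
Let add (f g : P) : P := fun i => f i + g i.
Let opp (f : P) : P := fun i => - f i.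
Let scale (a : A) (f : P) : P := fun i => a *: f i.

Let addA : associative add.
Proof.
by move=> f g h; apply: functional_extensionality_dep => i; exact: addrA.
Qed.
Let addC : commutative add.
Proof.
by move=> f g; apply: functional_extensionality_dep => i; exact: addrC.
Qed.
Let add0 : left_id zero add.
Proof.
by move=> f; apply: functional_extensionality_dep => i; exact: add0r.
Qed.
Let addN : left_inverse zero opp add.
Proof.
by move=> f; apply: functional_extensionality_dep => i; exact: addNr.
Qed.

HB.instance Definition _ := GRing.isZmodule.Build P addA addC add0 addN.

Let scaleA a b f : scale a (scale b f) = scale (a * b) f.
Proof. by apply: functional_extensionality_dep => i; exact: scalerA. Qed.
Let scale1 : left_id 1 scale.
Proof.
by move=> f; apply: functional_extensionality_dep => i; exact: scale1r.
Qed.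
Let scaleDr : right_distributive scale +%R.
Proof.
by move=> a f g; apply: functional_extensionality_dep => i; exact: scalerDr.
Qed.
Let scaleDl f : {morph scale^~ f : a b / a + b}.
Proof.
by move=> a b; apply: functional_extensionality_dep => i; exact: scalerDl.
Qed.

HB.instance Definition _ := GRing.Zmodule_isLmodule.Build A P
  scaleA scale1 scaleDr scaleDl.

End Product.

End Modules.

(** * Copowers *)

Section CopowerTheory.
Variables (R : pzRingType) (X : Type) (V : rmodType R).
Implicit Types (M : rmodType R) (z : copower X V) (x : X).

Lemma copower_ext z z' : (forall x, z x = z' x) -> z = z'.
Proof. by move=> zz'; apply/val_inj/funext. Qed.

Definition coproj x z : V := z x.
Arguments coproj x z /.

Fact coproj_linear x : linear (coproj x). Proof. by []. Qed.

HB.instance Definition _ x :=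
  GRing.isLinear.Build R^c (copower X V) V _ (coproj x) (@coproj_linear x).

Lemma finsupp_single x v :
  (fun y => if `[< y = x >] then v else 0) \in @finsupp_fun R X V.
Proof.
apply/asboolP; apply: sub_finite_set (finite_set1 x) => y /=.
by case: asboolP => [->//|_]; rewrite eqxx.
Qed.

Definition coinj x v : copower X V := Copower (finsupp_single x v).

Fact coinj_linear x : linear (coinj x).
Proof.
move=> a v w; apply: copower_ext => y.
rewrite -[RHS]/(a *: coinj x v y + coinj x w y) /=.
by case: asboolP => // _; rewrite scaler0 addr0.
Qed.

HB.instance Definition _ x :=
  GRing.isLinear.Build R^c V (copower X V) _ (coinj x) (@coinj_linear x).

Arguments coinj x v : simpl never.

Lemma coinjE x v y : coinj x v y = if `[< y = x >] then v else 0.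
Proof. by []. Qed.

Lemma coinj_eq x v : coinj x v x = v.
Proof. by rewrite coinjE asboolT. Qed.

Lemma coinj_neq x v y : y <> x -> coinj x v y = 0.
Proof. by move=> yx; rewrite coinjE asboolF. Qed.

Lemma copower_support z : finite_set [set x : {classic X} | z x != 0].
Proof. exact: asboolW (copower_valP z). Qed.

Section Lift.
Variables (M : rmodType R) (g : X -> {linear V -> M}).

(** The index type carries no choice structure, so it is given the classical
    one for the sum. *)
Definition colift z := \sum_(x \in [set: {classic X}]) g x (z x).

Fact colift_linear : linear colift.
Proof.
move=> a z z'; pose S w := [set x : {classic X} | w x != 0 :> V].
pose D := fset_set (S z `|` S z').
have finD : finite_set (S z `|` S z').
  by rewrite finite_setU; split; exact: copower_support.
have sum_D (w : copower X V) : (forall x, z x = 0 -> z' x = 0 -> w x = 0) ->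
    colift w = \sum_(x <- D) g x (w x).
  move=> w0; apply: fsbigTE => x; rewrite in_fset_set// notin_setE => /= Sx.
  rewrite w0 ?linear0//; apply/eqP/negP => /negP zx; apply: Sx;
    [left|right]; exact: zx.
rewrite (sum_D z) ?(sum_D z') ?sum_D//; last first.
  move=> x zx z'x; rewrite -[LHS]/(coproj x (a *: z + z')) linearP.
  by rewrite /= zx z'x scaler0 addr0.
rewrite scaler_sumr -big_split; apply: eq_bigr => x _ /=.
by rewrite -linearP.
Qed.

HB.instance Definition _ :=
  GRing.isLinear.Build R^c (copower X V) M _ colift colift_linear.

Lemma colift_coinj x v : colift (coinj x v) = g x v.
Proof.
rewrite /colift (@fsbigTE _ _ _ _ [fset (x : {classic X})]%fset).
  by rewrite big_seq_fset1 coinj_eq.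
by move=> y; rewrite inE => /eqP yx; rewrite coinj_neq ?linear0.
Qed.

End Lift.

Lemma copower_fset_sum (D : {fset {classic X}}) z :
    (forall x : {classic X}, z x != 0 -> x \in D) ->
  z = \sum_(k < size D) coinj (tnth (in_tuple D) k) (z (tnth (in_tuple D) k)).
Proof.
move=> zD; rewrite -(big_tnth _ _ _ xpredT (fun x => coinj x (z x))).
apply: copower_ext => y; rewrite -[RHS]/(coproj y _) linear_sum /=.
have [zy|/zD yD] := eqVneq (z y) 0.
  by rewrite zy big1// => x _; case: asboolP => // <-.
rewrite (big_fsetD1 (y : {classic X}))//= asboolT// big1_fset ?addr0// => x.
by rewrite !inE => /andP[/eqP xy _] _; rewrite asboolF// => yx; exact: xy.
Qed.

Lemma copower_decomp z : exists n (e : 'I_n -> X),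
  injective e /\ z = \sum_(k < n) coinj (e k) (z (e k)).
Proof.
pose D := fset_set [set x : {classic X} | z x != 0].
exists (size D), (fun k => tnth (in_tuple D) k); split.
  exact: (elimT (tuple_uniqP (in_tuple D)) (fset_uniq D)).
apply: copower_fset_sum => x zx; rewrite in_fset_set ?inE//.
exact: copower_support.
Qed.

Lemma copower_sum_out z n (e : 'I_n -> X) x :
    z = \sum_(k < n) coinj (e k) (z (e k)) -> (forall k, e k <> x) -> z x = 0.
Proof.
move=> -> ex; rewrite -[LHS]/(coproj x _) linear_sum big1// => k _ /=.
by rewrite asboolF// => xe; exact: (ex k).
Qed.

Lemma copower_map_ext M (f g : {linear copower X V -> M}) :
  (forall x v, f (coinj x v) = g (coinj x v)) -> f =1 g.
Proof.
move=> fg z; have [n [e [_ ->]]] := copower_decomp z.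
by rewrite !linear_sum; apply: eq_bigr.
Qed.

End CopowerTheory.

Arguments coinj {R X V} x v : simpl never.
Arguments coproj {R X V} x z /.
Arguments colift {R X V M} g z : simpl never.

(** The images of finitely many generators have finite supports, and the union
    of these supports the whole image; in this sense U is small. *)
Lemma fg_small (R : pzRingType) (X : Type) (U V : rmodType R)
    (f : {linear U -> copower X V}) : finitely_generated U ->
  exists n (e : 'I_n -> X),
    forall u, f u = \sum_(k < n) coinj (e k) (f u (e k)).
Proof.
move=> [m [g gen_g]].
pose S := \bigcup_(i in [set: 'I_m]) [set x : {classic X} | f (g i) x != 0].
have finS : finite_set S.
  by apply: bigcup_finite => [|i _]; [exact: finite_finset|exact: copower_support].
pose D := fset_set S.
exists (size D), (fun k => tnth (in_tuple D) k) => u.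
apply: copower_fset_sum => y fy.
rewrite in_fset_set// inE; apply: contrapT => yS; move/eqP: fy; apply.
have [a ->] := gen_g u; rewrite -[LHS]/(coproj y _) !linear_sum big1// => i _.
rewrite !linearZ /=; suff -> : f (g i) y = 0 by rewrite scaler0.
by apply: contrapT => /eqP fgy; apply: yS; exists i.
Qed.

(** * The class Add(U) *)

Section AddTheory.
Variables (R : pzRingType) (U : rmodType R).
Implicit Types (M C : rmodType R) (X : Type).

(** The complement in a direct summand decomposition is turned into a
    retraction, the form in which membership in Add(U) is used below. *)
Lemma Add_retract M : Add U M ->
  exists X (i : {linear M -> copower X U}) (p : {linear copower X U -> M}),
    cancel i p.
Proof.
case=> X [A [[A_cl [B [B_cl AB0 AB]]] [i [i_inj iA]]]].
exists X, i; have /choice[s sP] z : exists m, z - i m \in B.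
  have [a [b [aA bB ->]]] := AB z; have [m im] := (iA a).1 aA.
  by exists m; rewrite im addrAC subrr add0r.
have A_i m : i m \in A by apply/iA; exists m.
have zB := GRing.submod_closedB B_cl; have zA := GRing.submod_closedB A_cl.
have s_eq z m : z - i m \in B -> s z = m.
  move=> zm; apply/i_inj/eqP; rewrite -subr_eq0; apply/eqP/AB0.
    exact: zA.2.
  have -> : i (s z) - i m = (z - i m) - (z - i (s z)).
    by rewrite [RHS]addrC opprB subrKA.
  exact: zB.2.
have lin : linear s.
  move=> a z z'; apply: s_eq; rewrite linearP opprD addrACA -scalerBr.
  by apply: B_cl.2.
exists (linear_map lin) => m /=; apply: s_eq; rewrite subrr; exact: zB.1.
Qed.

Lemma Add_of_bijection M X (f : {linear copower X U -> M}) :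
  bijective f -> Add U M.
Proof.
move=> /linear_inverse[g [fK gK]]; exists X, (fun=> true); split; last first.
  exists g; split; first exact: can_inj gK.
  by move=> z; split=> // _; exists (f z).
split; first by [].
exists (fun z => z == 0); split=> [|z _ /eqP//|z]; last first.
  by exists z, 0; split=> //; [exact: eqxx | rewrite addr0].
split=> [|a x y /eqP-> /eqP->]; first exact: eqxx.
by rewrite scaler0 addr0; exact: eqxx.
Qed.

Lemma Add_copower X : Add U (copower X U).
Proof. by apply: (@Add_of_bijection _ X idfun); exists idfun. Qed.

Lemma Add_self : Add U U.
Proof.
apply: (@Add_of_bijection _ unit (coproj tt)); exists (coinj tt) => [z|u] /=.
  by apply: copower_ext => -[]; rewrite coinj_eq.
exact: coinj_eq.
Qed.

End AddTheory.

(** * The maximal submodule of a cyclic uniserial module *)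

Lemma cyclic_closed (R : pzRingType) (U : rmodType R) (v : U) :
  submod_closed ((fun x => `[< exists a, x = a *: v >]) : {pred U}).
Proof.
split=> [|a x y /asboolP[b ->] /asboolP[c ->]]; apply/asboolP.
  by exists 0; rewrite scale0r.
by exists (a * b + c); rewrite scalerDl scalerA.
Qed.

(** Of the cyclic submodules spanned by finitely many generators, one contains
    all the others. *)
Lemma fg_uniserial_cyclic (R : pzRingType) (U : rmodType R) :
  finitely_generated U -> uniserial U ->
  exists u : U, forall x, exists a, x = a *: u.
Proof.
move=> [n [g gen_g]] U_unis.
pose cyc (v : U) : {pred U} := fun x => `[< exists a, x = a *: v >].
have cycP v : submod_closed (cyc v) by exact: cyclic_closed.
have cyc_self v : v \in cyc v by apply/asboolP; exists 1; rewrite scale1r.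
suff [u gu] : exists u, forall k, g k \in cyc u.
  exists u => x; apply/asboolP; have [a ->] := gen_g x.
  elim/big_rec: _ => [|k y _ yu]; first exact: (cycP u).1.
  exact: (cycP u).2.
elim: n => [|n IHn] in g {gen_g} *; first by exists 0; case.
have [u gu] := IHn (fun k => g (lift ord0 k)).
have [ug|gu0] := U_unis _ _ (cycP u) (cycP (g ord0)).
  exists (g ord0) => k; have [j ->|->] := unliftP ord0 k; last exact: cyc_self.
  exact/ug/gu.
exists u => k; have [j ->|->] := unliftP ord0 k; first exact: gu.
exact/gu0/cyc_self.
Qed.

Section Local.
Variables (R : pzRingType) (U : rmodType R) (u : U).
Hypotheses (u_gen : forall x, exists a, x = a *: u) (u_neq0 : u != 0).
Hypothesis U_uniserial : uniserial U.

Definition maximal_sub : {pred U} := fun x => `[< ~ exists a, u = a *: x >].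

Local Notation N := maximal_sub.

Lemma notin_maximal_sub x : x \notin N -> exists a, u = a *: x.
Proof. by move=> xN; apply: contrapT => ux; move/asboolP: xN. Qed.

(** A sum of two elements lies in the larger of the two cyclic submodules
    they span, so it generates U only if one of them does. *)
Lemma maximal_sub_closed : submod_closed N.
Proof.
split=> [|a x y /asboolP xN /asboolP yN]; apply/asboolP.
  by case=> a; rewrite scaler0 => /eqP; rewrite (negPf u_neq0).
case=> b ub; have [xy|yx] := U_uniserial (cyclic_closed x) (cyclic_closed y).
  have /asboolP[c xc] : x \in [pred x | `[< exists a, x = a *: y >]].
    by apply: xy; apply/asboolP; exists 1; rewrite scale1r.
  apply: yN; exists (b * (a * c + 1)).
  by rewrite ub xc -scalerA scalerDl scale1r -scalerA.
have /asboolP[c yc] : y \in [pred y | `[< exists a, y = a *: x >]].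
  by apply: yx; apply/asboolP; exists 1; rewrite scale1r.
by apply: xN; exists (b * (a + c)); rewrite ub yc -scalerA scalerDl.
Qed.

Lemma gen_notin_maximal_sub : u \notin N.
Proof. by apply/asboolP => -[]; exists 1; rewrite scale1r. Qed.

Lemma into_maximal_sub (f : {linear U -> U}) :
  f u \in N -> forall x, f x \in N.
Proof.
have [N0 N_cl] := maximal_sub_closed.
move=> fu x; have [a ->] := u_gen x; rewrite linearZ /=.
by rewrite -[_ *: _]addr0; apply: N_cl.
Qed.

Lemma surjective_of_gen (f : {linear U -> U}) : f u \notin N ->
  forall y, exists x, f x = y.
Proof.
move=> /notin_maximal_sub[a ua] y; have [b ->] := u_gen y.
by exists (b *: (a *: u)); rewrite !linearZ /= -ua.
Qed.

Section SimpleQuotient.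
Variables (S : rmodType R) (c : {linear U -> S}).
Hypothesis c_surj : forall y, exists x, c x = y.
Hypothesis c_ker : forall x, c x = 0 <-> x \in N.

(** If f x is nonzero it generates the simple module S, so u is congruent to
    a multiple of x modulo ker f; as ker f is comparable with the span of x,
    either u is itself a multiple of x or f x = 0. *)
Lemma kills_maximal_sub (f : {linear U -> S}) x : x \in N -> f x = 0.
Proof.
move=> xN; apply: contrapT => fx; have [w cw] := c_surj (f x).
have [v cv] := c_surj (f u).
have /notin_maximal_sub[a ua] : w \notin N.
  by apply/negP => /c_ker; rewrite cw.
have [b vb] := u_gen v.
have fu : f (u - (b * a) *: x) = 0.
  by rewrite linearB linearZ /= -cw -cv vb ua !linearZ /= scalerN scalerA subrr.
have ker_cl : submod_closed ((fun x => f x == 0) : {pred U}).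
  split=> [|a' y z /eqP fy /eqP fz]; apply/eqP; first exact: linear0.
  by rewrite linearP fy fz scaler0 addr0.
have [fx'|xf] := U_uniserial ker_cl (cyclic_closed x).
  have /asboolP[d ud] := fx' _ (introT eqP fu).
  move/asboolP: xN; apply; exists (d + b * a).
  by rewrite scalerDl -ud subrK.
by apply: fx; apply/eqP/xf; apply/asboolP; exists 1; rewrite scale1r.
Qed.

End SimpleQuotient.
End Local.

(** * Covers by Add(U) *)

Section Essential.
Variables (R : pzRingType) (U : rmodType R) (X : Type).
Hypothesis U_uniserial : uniserial U.
Variables (Z : {pred U}) (z0 : U).
Hypotheses (Z_closed : submod_closed Z) (Zz0 : z0 \in Z) (z0_neq0 : z0 != 0).

(** The elements of U^(X) with coordinates in a nonzero submodule Z are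
    essential. Coordinates are pushed into Z one at a time: if the span of
    (r y) x does not lie in Z, it contains Z by uniseriality, so some multiple
    of (r y) x is the nonzero element z0 of Z. *)
Lemma copower_essential (y : copower X U) : y <> 0 ->
  exists r, r *: y <> 0 /\ forall x, (r *: y) x \in Z.
Proof.
have scaleZ a w : w \in Z -> a *: w \in Z.
  by move=> Zw; rewrite -[_ *: _]addr0; apply: Z_closed.2 => //; exact: Z_closed.1.
have on_finite n (e : 'I_n -> X) : y <> 0 ->
    exists r, r *: y <> 0 /\ forall k, (r *: y) (e k) \in Z.
  elim: n => [|n IHn] in e *.
    by move=> y0; exists 1; rewrite scale1r; split=> // -[].
  move=> /(IHn (fun k => e (lift ord0 k)))[r [ry0 ryZ]].
  pose w := (r *: y) (e ord0).
  have [Zw|wZ] := U_uniserial Z_closed (cyclic_closed w); last first.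
    exists r; split=> // k; have [j ->|->] := unliftP ord0 k; first exact: ryZ.
    by apply: wZ; apply/asboolP; exists 1; rewrite scale1r.
  have /asboolP[a z0E] := Zw _ Zz0; exists (a * r).
  have e0E : (a *: (r *: y)) (e ord0) = z0 by [].
  rewrite -scalerA; split=> [ary0|k].
    by move: z0_neq0; rewrite -e0E ary0 eqxx.
  have [j ->|->] := unliftP ord0 k; last by rewrite e0E.
  exact: scaleZ (ryZ j).
have [n [e [_ yE]]] := copower_decomp y.
move=> /(on_finite n e)[r [ry0 ryZ]]; exists r; split=> // x.
have [[k <-]//|ex] := pselect (exists k, e k = x).
rewrite -[(r *: y) x]/(r *: y x) (copower_sum_out yE) ?scaler0 ?Z_closed.1//.
by move=> k xk; apply: ex; exists k.
Qed.

End Essential.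

Section CoverUnits.
Variables (R : pzRingType) (K : rmodType R -> Prop) (C A : rmodType R).
Variable p : {linear C -> A}.
Hypothesis p_cover : is_cover K p.

(** Subtracting from the identity an endomorphism killed by the cover leaves
    the cover unchanged, so the difference is an automorphism. *)
Lemma cover_unit (q : {linear C -> C}) : (forall x, p (q x) = 0) ->
  exists k : {linear C -> C},
    (forall x, p (k x) = p x) /\ forall x, k (x - q x) = x.
Proof.
move=> pq; pose h := linear_map (linear_sub_comp idfun q idfun).
have ph : p \o h =1 p by move=> x /=; rewrite linearB pq subr0.
have [k [kK hK]] := linear_inverse (p_cover.2 h ph).
exists k; split=> [x|]; last exact: kK.
by rewrite -[in RHS](hK x); exact/esym/ph.
Qed.

(** Gaussian elimination: a square matrix of endomorphisms killed by a cover
    has no nonzero fixed vector, as each pivot 1 - q is invertible. *)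
Lemma cover_no_fixed n (y : 'I_n -> C) (q : 'I_n -> 'I_n -> {linear C -> C}) :
    (forall i j x, p (q i j x) = 0) ->
    (forall i, y i = \sum_j q i j (y j)) ->
  forall i, y i = 0.
Proof.
elim: n => [|n IHn] in y q *; first by move=> _ _ [].
move=> pq yE; have [k [pk kE]] := cover_unit (pq ord0 ord0).
pose l i := lift (@ord0 n) i.
have y0E : y ord0 = \sum_j k (q ord0 (l j) (y (l j))).
  rewrite -[LHS]kE {1}yE big_ord_recl addrAC subrr add0r.
  exact: linear_sum.
pose q' i j := linear_map (linear_sub_comp (q (l i) (l j))
  (k \o q ord0 (l j) : {linear C -> C}) (\- q (l i) ord0 : {linear C -> C})).
have y'0 : forall i, y (l i) = 0.
  apply: (IHn _ q') => [i j x|i] /=; first by rewrite opprK linearD !pq addr0.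
  rewrite yE big_ord_recl {1}y0E linear_sum -big_split; apply: eq_bigr => j _ /=.
  by rewrite opprK addrC.
move=> i; have [j ->|->] := unliftP ord0 i; first exact: y'0.
by rewrite y0E big1// => j _; rewrite y'0 !linear0.
Qed.

End CoverUnits.

Section Covering.
Variables (R : pzRingType) (U : rmodType R).
Hypothesis U_fg : finitely_generated U.
Hypothesis U_covering : covering (Add U).

Section KernelNilpotent.
Variables (C0 A0 : rmodType R) (p0 : {linear C0 -> A0}).
Hypothesis p0_cover : is_cover (Add U) p0.

Let P0 : {linear copower nat C0 -> copower nat A0} :=
  colift (fun n => coinj n \o p0 : {linear C0 -> copower nat A0}).

Let P0_coinj n v : P0 (coinj n v) = coinj n (p0 v).
Proof. exact: colift_coinj. Qed.

Let P0E z n : P0 z n = p0 (z n).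
Proof.
rewrite -[LHS]/((coproj n \o P0) z) -[RHS]/((p0 \o coproj n) z).
apply: (@copower_map_ext _ _ _ _ (coproj n \o P0) (p0 \o coproj n)) => m v.
rewrite [LHS]/= P0_coinj /=.
by case: asboolP => // _; rewrite linear0.
Qed.

(** P0 is a precover, so its source is the source of a cover p of A0^(nat) plus
    a complement killed by P0. The projection d onto the complement is an
    idempotent matrix with entries killed by p0, which cover_no_fixed shows
    to be zero; hence the two sources are isomorphic. *)
Let countable_copower_cover : exists (C : rmodType R)
    (p : {linear C -> copower nat A0}) (t : {linear copower nat C0 -> C})
    (s : {linear C -> copower nat C0}),
  [/\ is_cover (Add U) p, forall z, p (t z) = P0 z,
      cancel s t & cancel t s].
Proof.
have [C [p p_cover]] := U_covering (copower nat A0).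
have [[AddC p_lift] _] := p_cover; have [[AddC0 p0_lift] _] := p0_cover.
have [X [i [r ir]]] := Add_retract AddC.
have /choice[t0 t0E] n : exists t : {linear C0 -> C}, forall w,
    p (t w) = coinj n (p0 w).
  by have [t tE] := p_lift _ (coinj n \o p0) AddC0; exists t; exact: tE.
pose t : {linear copower nat C0 -> C} := colift t0.
have t_coinj n v : t (coinj n v) = t0 n v by exact: colift_coinj.
have tE z : p (t z) = P0 z.
  apply: (@copower_map_ext _ _ _ _ (p \o t) P0) => n v.
  by rewrite -[LHS]/(p (t (coinj n v))) t_coinj t0E P0_coinj.
have /choice[s0 s0E] x : exists s : {linear U -> copower nat C0}, forall w,
    P0 (s w) = p (r (coinj x w)).
  pose th : {linear U -> copower nat A0} := p \o (r \o coinj x).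
  have [n [e eE]] := fg_small th U_fg.
  have /choice[la laE] k : exists la : {linear U -> C0}, forall w,
      p0 (la w) = th w (e k).
    have [la laE] := p0_lift _ (coproj (e k) \o th) (Add_self U).
    by exists la; exact: laE.
  exists (linear_map (sum_of_linear
    (fun k => coinj (e k) \o la k : {linear U -> copower nat C0}))) => w /=.
  rewrite linear_sum -[RHS]/(th w) [RHS]eE; apply: eq_bigr => k _.
  by rewrite P0_coinj laE.
pose s : {linear C -> copower nat C0} := colift s0 \o i.
have sE w : P0 (s w) = p w.
  rewrite -{2}(ir w) -[LHS]/((P0 \o colift s0) (i w)) -[RHS]/((p \o r) (i w)).
  apply: (@copower_map_ext _ _ _ _ (P0 \o colift s0) (p \o r)) => x v.
  by rewrite -[RHS]s0E -[LHS]/(P0 (colift s0 _)) colift_coinj.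
have [|k [kK Kk]] := linear_inverse (p_cover.2 (t \o s) _).
  by move=> w /=; rewrite tE sE.
have pk w : p (k w) = p w by rewrite -[in RHS](Kk w) /= tE sE.
pose s' : {linear C -> copower nat C0} := s \o k.
have s'K : cancel s' t by move=> w; exact: Kk.
exists C, p, t, s'; split=> // z.
pose d : {linear copower nat C0 -> copower nat C0} :=
  linear_map (linear_sub_comp idfun t s').
have dE w : d w = w - s' (t w) by [].
have td w : t (d w) = 0 by rewrite dE linearB s'K subrr.
have dd w : d (d w) = d w by rewrite [LHS]dE td linear0 subr0.
have pd w n : p0 (d w n) = 0.
  rewrite -P0E dE linearB.
  rewrite -[P0 (s' _)]/(P0 (s _)) sE pk tE subrr.
  by [].
have [n [e [_ zE]]] := copower_decomp (d z).
have dz0 := @cover_no_fixed _ _ _ _ _ p0_cover n (fun k => d z (e k))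
  (fun i j => coproj (e i) \o (d \o coinj (e j))).
apply/esym/eqP; rewrite -subr_eq0 -[_ - _]/(d z) zE big1// => j _.
rewrite dz0 ?linear0// => [i1 j1 x|i1]; first exact: pd.
rewrite -{1}dd {1}zE -[LHS]/(coproj (e i1) _) !linear_sum.
by apply: eq_bigr.
Qed.

(** On C0^(nat) the map z |-> z - sh z is compatible with P0, hence
    invertible; solving z - sh z = c 0 in copy 0 forces z n = c n, and z has
    finite support. *)
Lemma cover_kernel_nilpotent (q : nat -> {linear C0 -> C0}) (c : nat -> C0) :
    (forall n x, p0 (q n x) = 0) -> (forall n, c n.+1 = q n (c n)) ->
  exists n, c n = 0.
Proof.
move=> pq cE; have [C [p [t [s [p_cover tE sK tK]]]]] := countable_copower_cover.
pose sh : {linear copower nat C0 -> copower nat C0} :=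
  colift (fun n => coinj n.+1 \o q n : {linear C0 -> copower nat C0}).
have sh_coinj n v : sh (coinj n v) = coinj n.+1 (q n v) by exact: colift_coinj.
have sh0 z : sh z 0%N = 0.
  rewrite -[LHS]/((coproj 0%N \o sh) z).
  apply: (@copower_map_ext _ _ _ _ (coproj 0%N \o sh) \0) => n v.
  by rewrite [LHS]/= sh_coinj /= asboolF.
have shS z n : sh z n.+1 = q n (z n).
  rewrite -[LHS]/((coproj n.+1 \o sh) z) -[RHS]/((q n \o coproj n) z).
  apply: (@copower_map_ext _ _ _ _ (coproj n.+1 \o sh) (q n \o coproj n)) => m v.
  rewrite [LHS]/= sh_coinj /=.
  case: asboolP => [[->]|nm]; first by rewrite asboolT.
  by rewrite asboolF ?linear0// => nm'; apply: nm; rewrite nm'.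
have Psh z : P0 (sh z) = 0.
  apply: copower_ext => n; rewrite P0E; case: n => [|n]; last by rewrite shS pq.
  by rewrite sh0 linear0.
pose h0 := linear_map (linear_sub_comp idfun sh idfun).
have [|k [kK Kk]] := linear_inverse (p_cover.2 (t \o (h0 \o s)) _).
  by move=> w /=; rewrite tE linearB Psh subr0 -tE sK.
pose z := s (k (t (coinj 0%N (c 0%N)))).
have zE : z - sh z = coinj 0%N (c 0%N).
  by rewrite -[RHS]tK -[in RHS](Kk (t _)) /= tK.
have zc n : z n = c n.
  elim: n => [|n IHn].
    by rewrite -[RHS](coinj_eq 0%N) -zE -[RHS]/(z 0%N - sh z 0%N) sh0 subr0.
  have := congr1 (fun w : copower nat C0 => w n.+1) zE.
  rewrite -[LHS]/(z n.+1 - sh z n.+1) shS IHn -cE coinj_neq// => /eqP.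
  by rewrite subr_eq0 => /eqP.
have [n [e [_ eE]]] := copower_decomp z.
(* an index beyond the support of z *)
exists (\max_(j < n) e j).+1; rewrite -zc; apply: (copower_sum_out eE) => j ej.
by have := leq_bigmax (F := e) j; rewrite ej ltnn.
Qed.

End KernelNilpotent.

Section Cyclic.
Variable u : U.
Hypotheses (u_gen : forall x, exists a, x = a *: u) (u_neq0 : u != 0).
Hypothesis U_uniserial : uniserial U.
Local Notation N := (maximal_sub u).

Let simple_quotient := quotient_module (maximal_sub_closed u_neq0 U_uniserial).

(** Were ker g nonzero, the endomorphism psi G i of the cover, where G applies g
    to every coordinate, would be injective while killing an essential
    submodule, and the cover of a simple module would be zero. *)
Lemma surjective_endo_injective (g : {linear U -> U}) :
  (forall y, exists x, g x = y) -> injective g.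
Proof.
move=> g_surj; apply: raddf_inj => z0 gz0; apply: contrapT => /eqP z0_neq0.
have [S [c [c_surj c_ker]]] := simple_quotient.
(* an element outside N generates U, and g is not zero *)
have kerN x : g x = 0 -> x \in N.
  move=> gx0; apply: contrapT => /negP/notin_maximal_sub[a ua].
  have [y gy] := g_surj z0; have [b yb] := u_gen y.
  by move: z0_neq0; rewrite -gy yb ua !linearZ /= gx0 !scaler0 eqxx.
have [C [p [[AddC p_lift] p_inj]]] := U_covering S.
have [X [i [r ir]]] := Add_retract AddC.
have /choice[f fE] x : exists f : {linear U -> S}, forall v,
    f (g v) = p (r (coinj x v)).
  apply: (factor_surjective (f := p \o (r \o coinj x)) g_surj) => v gv.
  by apply: (kills_maximal_sub u_gen U_uniserial c_surj c_ker); exact: kerN.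
have [psi psiE] := p_lift _ (colift f) (Add_copower U X).
pose G : {linear copower X U -> copower X U} :=
  colift (fun x => coinj x \o g : {linear U -> copower X U}).
have G_coinj x v : G (coinj x v) = coinj x (g v) by exact: colift_coinj.
have GE z x : G z x = g (z x).
  rewrite -[LHS]/((coproj x \o G) z) -[RHS]/((g \o coproj x) z).
  apply: (@copower_map_ext _ _ _ _ (coproj x \o G) (g \o coproj x)) => y v.
  rewrite [LHS]/= G_coinj /=.
  by case: asboolP => // _; rewrite linear0.
have h_bij := p_inj (psi \o (G \o i)) _.
have h_inj : injective (psi \o (G \o i)).
  apply/bij_inj/h_bij => m; rewrite -[RHS]/(p m) -[in RHS](ir m).
  rewrite -[LHS]/((p \o psi) (G (i m))) psiE.
  rewrite -[LHS]/((colift f \o G) (i m)) -[RHS]/((p \o r) (i m)).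
  apply: (@copower_map_ext _ _ _ _ (colift f \o G) (p \o r)) => x v.
  by rewrite -[RHS]fE -[LHS]/(colift f (G _)) G_coinj colift_coinj.
have C0 m : m = 0 :> C.
  apply: contrapT => m0; have im0 : i m <> 0.
    by move=> im0; apply: m0; rewrite -(ir m) im0 linear0.
  have ker_cl : submod_closed ((fun x => g x == 0) : {pred U}).
    split=> [|a y z /eqP gy /eqP gz]; apply/eqP; first exact: linear0.
    by rewrite linearP gy gz scaler0 addr0.
  have [a [aim0 aimZ]] := copower_essential U_uniserial ker_cl
    (introT eqP gz0) z0_neq0 im0.
  apply: aim0; rewrite -linearZ /=; suff -> : a *: m = 0 by rewrite linear0.
  apply: h_inj; rewrite linear0 /= linearZ /=.
  suff -> : G (a *: i m) = 0 by rewrite linear0.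
  by apply: copower_ext => x; rewrite GE; apply/eqP; exact: aimZ.
have [s sE] := p_lift _ c (Add_self U).
have := gen_notin_maximal_sub u; apply/negP; rewrite negbK; apply/c_ker.
by rewrite -(sE u) /= (C0 (s u)) linear0.
Qed.

Lemma endo_invertible (f : {linear U -> U}) : f u \notin N ->
  exists g : {linear U -> U}, cancel f g /\ cancel g f.
Proof.
move=> /(surjective_of_gen u_gen) f_surj; apply: linear_inverse.
exact: inj_surj_bijective (surjective_endo_injective f_surj) f_surj.
Qed.

(** The endomorphisms s f_n t of the cover C, where s lifts U -> S and t is a
    retraction of s, are killed by p; the retraction exists because some
    coordinate of s is not inside N, hence invertible. *)
Lemma radical_endos_nilpotent (f : nat -> {linear U -> U}) (x : nat -> U) :
    (forall n v, f n v \in N) -> (forall n, x n.+1 = f n (x n)) ->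
  exists n, x n = 0.
Proof.
move=> fN xE; have [S [c [c_surj c_ker]]] := simple_quotient.
have [C [p p_cover]] := U_covering S; have [[AddC p_lift] _] := p_cover.
have [X [i [r ir]]] := Add_retract AddC.
have [s sE] := p_lift _ c (Add_self U).
(* otherwise the map U -> S, which factors through s, would vanish *)
have [y yN] : exists y, i (s u) y \notin N.
  apply: contrapT => allN; move: (gen_notin_maximal_sub u).
  apply/negP; rewrite negbK; apply/c_ker; rewrite -(sE u) /= -[s u]ir.
  have [n [e [_ ->]]] := copower_decomp (i (s u)).
  rewrite !linear_sum big1// => k _.
  apply: (@kills_maximal_sub _ _ _ u_gen U_uniserial _ _ c_surj c_ker
    (p \o (r \o coinj (e k)))).
  by apply: contrapT => /negP skN; apply: allN; exists (e k).
have [b [bK _]] := @endo_invertible (coproj y \o (i \o s)) yN.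
pose t : {linear C -> U} := b \o (coproj y \o i).
have ts v : t (s v) = v by exact: bK.
have [||n sxn] := @cover_kernel_nilpotent _ _ _ p_cover
  (fun n => s \o (f n \o t)) (fun n => s (x n)).
- by move=> n v; rewrite -[LHS]/((p \o s) _) sE; apply/c_ker/fN.
- by move=> n; rewrite xE -[RHS]/(s (f n (t (s (x n))))) ts.
by exists n; rewrite -(ts (x n)) sxn linear0.
Qed.

End Cyclic.
End Covering.

(** * Elements of a direct limit *)

Section DirectLimitElements.
Variables (R : pzRingType) (d : Order.disp_t) (I : preorderType d).
Variables (M : I -> rmodType R).
Variable f : forall i j : I, (i <= j)%O -> {linear M i -> M j}.
Variables (L : rmodType R) (l : forall i, {linear M i -> L}).
Hypotheses (I_directed : directed I) (f_system : is_system f).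
Hypothesis L_limit : is_direct_limit f l.

(** The canonical map from L to its quotient by the union of the images of the
    stages agrees with zero on every stage, hence is zero. *)
Lemma limit_element (y : L) : exists i (m : M i), l i m = y.
Proof.
have [[i0] dirI] := I_directed; have [l_cocone L_univ] := L_limit.
pose W : {pred L} := fun y => `[< exists i (m : M i), l i m = y >].
have W_closed : submod_closed W.
  split=> [|a _ _ /asboolP[i [m <-]] /asboolP[j [m' <-]]]; apply/asboolP.
    by exists i0, 0; exact: linear0.
  have [k [ik jk]] := dirI i j; exists k, (a *: f ik m + f jk m').
  by rewrite linearP -(l_cocone _ _ ik m) -(l_cocone _ _ jk m').
have [Q [c [c_surj c_ker]]] := quotient_module W_closed.
have [|h [_ h_uniq]] := L_univ Q (fun i => \0 : {linear M i -> Q}).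
  by move=> i j ij m.
have c0 : c =1 \0.
  move=> z; rewrite (h_uniq c) ?(h_uniq \0)// => i m /=.
  by apply/c_ker/asboolP; exists i, m.
by apply/asboolP/c_ker; exact: c0.
Qed.

(** An element that is nonzero at every later stage survives in the product
    modulo eventually vanishing families, hence in the limit. *)
Lemma limit_zero i (m : M i) : l i m = 0 -> exists j (ij : (i <= j)%O), f ij m = 0.
Proof.
have [_ dirI] := I_directed; have [_ f_comp] := f_system.
have [_ L_univ] := L_limit.
pose W : {pred product M} :=
  fun s => `[< exists k, forall j, (k <= j)%O -> s j = 0 >].
have W_closed : submod_closed W.
  split=> [|a s s' /asboolP[k s0] /asboolP[k' s'0]]; apply/asboolP.
    by exists i.
  have [k2 [kk k'k]] := dirI k k'; exists k2 => j kj.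
  rewrite -[LHS]/(a *: s j + s' j) s0 ?s'0 ?scaler0 ?addr0//;
    exact: Order.PreorderTheory.le_trans kj.
have [Q [c [_ c_ker]]] := quotient_module W_closed.
pose tail i' (x : M i') : product M := fun j =>
  if pselect (i' <= j)%O is left ij then f ij x else 0.
have tailE i' j (ij : (i' <= j)%O) x : tail i' x j = f ij x.
  by rewrite /tail; case: pselect => // ij'; rewrite (bool_irrelevance ij ij').
have tail_lin i' : linear (c \o @tail i').
  move=> a x y; rewrite /= -linearP; congr (c _).
  apply: functional_extensionality_dep => j.
  rewrite -[RHS]/(a *: tail i' x j + tail i' y j) /tail.
  by case: pselect => // ij; [rewrite linearP | rewrite scaler0 addr0].
have [|h [hl _]] := L_univ Q (fun i' => linear_map (tail_lin i')).
  move=> i1 j ij x /=; apply/eqP; rewrite -subr_eq0 -linearB; apply/eqP/c_ker.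
  apply/asboolP; exists j => k jk.
  have ik := Order.PreorderTheory.le_trans ij jk.
  rewrite -[LHS]/(tail _ (f ij x) k - tail _ x k) (tailE _ _ jk) (tailE _ _ ik).
  by rewrite -(f_comp _ _ _ ij jk ik) subrr.
move=> lm0; have /c_ker/asboolP[k tail0] : c (tail i m) = 0.
  by rewrite -[LHS]hl /= lm0 linear0.
have [j [ij kj]] := dirI i k; exists j, ij.
by rewrite -tailE tail0.
Qed.

End DirectLimitElements.

(** * Direct limits over a local endomorphism ring with T-nilpotent radical *)

Lemma chain_finite (T : Type) (F : set (set T)) n (e : 'I_n.+1 -> T) :
    total_on F subset -> (forall k, (\bigcup_(Y in F) Y) (e k)) ->
  exists2 Y, F Y & forall k, Y (e k).
Proof.
move=> F_tot; elim: n => [|n IHn] in e * => eF.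
  by have [Y FY Ye] := eF ord0; exists Y => // k; rewrite ord1.
have [Y FY Ye] := IHn (fun k => e (lift ord0 k)) (fun k => eF _).
have [Y' FY' Ye'] := eF ord0.
have [YY'|Y'Y] := F_tot _ _ FY FY'; [exists Y'|exists Y] => // k;
  have [j ->|->] := unliftP ord0 k; by [|apply: YY'|apply: Y'Y].
Qed.

Section Bass.
Variables (R : pzRingType) (U : rmodType R) (N : {pred U}).
Hypothesis U_fg : finitely_generated U.
Hypothesis N_closed : submod_closed N.
(* This form admits the zero module, with N the whole of it. *)
Hypothesis N_proper : (forall v, v \in N) -> forall v : U, v = 0.
Hypothesis N_local : forall f : {linear U -> U}, ~ (forall v, f v \in N) ->
  exists g : {linear U -> U}, cancel f g /\ cancel g f.
Hypothesis N_nilpotent : forall (f : nat -> {linear U -> U}) (x : nat -> U),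
  (forall n v, f n v \in N) -> (forall n, x n.+1 = f n (x n)) ->
  exists n, x n = 0.

(** Gaussian elimination over the local ring End(U): independence modulo
    N-valued maps provides an entry of the column psi 0 that is not N-valued,
    hence an invertible pivot, with which the other columns are cleared. *)
Lemma independent_mod_injective X n (psi : 'I_n -> {linear U -> copower X U}) :
    (forall d : 'I_n -> {linear U -> U},
      (forall v x, (\sum_k psi k (d k v)) x \in N) -> forall k v, d k v \in N) ->
  forall z : 'I_n -> U, \sum_k psi k (z k) = 0 -> forall k, z k = 0.
Proof.
elim: n => [|n IHn] in psi *; first by move=> _ z _ [].
move=> psi_indep z sum0.
have [allN|notN] := pselect (forall v, v \in N).
  by move=> k; exact: N_proper.
have [x [v psiN]] : exists x v, psi ord0 v x \notin N.
  apply: contrapT => noN; apply: notN => v.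
  (* test independence on the combination that selects the column psi 0 *)
  have := psi_indep (fun k => if k == ord0 then idfun : {linear U -> U} else \0).
  move=> /(_ _ ord0 v); apply=> w x; rewrite big_ord_recl big1 ?addr0 => [|k _].
    by apply: contrapT => /negP psiN; apply: noN; exists x, w.
  by rewrite linear0.
have [|t [tK Kt]] := @N_local (coproj x \o psi ord0).
  by move=> /(_ v); apply/negP.
pose l (k : 'I_n) := lift ord0 k.
pose g k : {linear U -> U} := t \o (coproj x \o psi (l k)).
pose psi' (k : 'I_n) := linear_map (linear_sub_comp (psi (l k)) (g k) (psi ord0)).
have psi'E (y : 'I_n -> U) : \sum_k psi' k (y k) =
    psi ord0 (- \sum_k g k (y k)) + \sum_k psi (l k) (y k).
  rewrite linearN linear_sum addrC -sumrN -big_split.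
  by apply: eq_bigr.
have psi'_indep (d : 'I_n -> {linear U -> U}) :
    (forall v x, (\sum_k psi' k (d k v)) x \in N) ->
    forall k v, d k v \in N.
  move=> dN k w.
  pose d0 := linear_map (sum_of_linear (fun k => \- (g k \o d k) : {linear U -> U})).
  have := psi_indep (fun k => if unlift ord0 k is Some j then d j else d0).
  move=> /(_ _ (l k) w); rewrite liftK; apply=> w' x'.
  rewrite big_ord_recl unlift_none.
  under eq_bigr do rewrite liftK.
  have := dN w' x'; rewrite psi'E; congr (_ \in N); congr (coproj x' (_ + _)).
  by rewrite /d0 /= sumrN.
have z0E : z ord0 = - \sum_k g k (z (l k)).
  apply: (can_inj tK); apply/eqP; rewrite -subr_eq0 linearN opprK; apply/eqP.
  have sum_x : coproj x (\sum_k psi (l k) (z (l k))) =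
    \sum_k coproj x (psi (l k) (z (l k))) by exact: linear_sum.
  transitivity (coproj x (\sum_k psi k (z k))); last by rewrite sum0.
  rewrite big_ord_recl -[RHS]/(coproj x (psi ord0 (z ord0)) + coproj x _) sum_x.
  congr (_ + _); rewrite linear_sum; apply: eq_bigr => k _.
  exact: Kt.
have zl k : z (l k) = 0.
  apply: (IHn psi' psi'_indep (fun k => z (l k))).
  by rewrite psi'E -z0E -[RHS]sum0 big_ord_recl.
move=> k; have [j ->|->] := unliftP ord0 k; first exact: zl.
by rewrite z0E big1 ?oppr0// => j _; rewrite zl linear0.
Qed.

Section Limit.
Variables (d : Order.disp_t) (I : preorderType d) (M : I -> rmodType R).
Variable f : forall i j : I, (i <= j)%O -> {linear M i -> M j}.
Variables (L : rmodType R) (l : forall i, {linear M i -> L}).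
Hypotheses (I_directed : directed I) (f_system : is_system f).
Hypothesis AddM : forall i, Add U (M i).
Hypothesis L_limit : is_direct_limit f l.

Definition stagewise (al : {linear U -> L}) :=
  exists i (psi : {linear U -> M i}), forall v, l i (psi v) = al v.

(** With H the End(U)-module of stagewise maps and J the ideal of endomorphisms
    with image in N, this is membership in HJ. *)
Definition radical (phi : U -> L) :=
  exists n (al : 'I_n -> {linear U -> L}) (j : 'I_n -> {linear U -> U}),
  [/\ forall k, stagewise (al k), forall k v, j k v \in N &
      forall v, phi v = \sum_k al k (j k v)].

Lemma radical_comp phi (g : {linear U -> U}) :
  radical phi -> radical (phi \o g).
Proof.
move=> [n [al [j [al_st jN phiE]]]]; exists n, al, (fun k => j k \o g).
by split=> // [k v|v] /=; [exact: jN | exact: phiE].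
Qed.

Lemma radical_sub_stagewise phi al (j : {linear U -> U}) :
    radical phi -> stagewise al -> (forall v, j v \in N) ->
  radical (fun v => phi v - al (j v)).
Proof.
move=> [n [be [i [be_st iN phiE]]]] al_st jN.
exists n.+1, (fun k => if unlift ord0 k is Some k' then be k' else al).
exists (fun k => if unlift ord0 k is Some k' then i k' else \- j : {linear U -> U}).
split=> [k|k v|v]; try case: unliftP => //.
  move=> _; rewrite -[\- j]/(\- j) -[_ v]/(- j v) -sub0r addrC -scaleN1r.
  by apply: N_closed.2; [exact: jN | exact: N_closed.1].
rewrite phiE big_ord_recl unlift_none linearN addrC; congr (_ + _).
by apply: eq_bigr => k _; rewrite liftK.
Qed.

(** Linear independence of Y in H / HJ over the division ring End(U) / J, stated
    without forming these quotients. *)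
Definition independent (Y : set {linear U -> L}) :=
  Y `<=` stagewise /\
  forall n (e : 'I_n -> {linear U -> L}) (c : 'I_n -> {linear U -> U}),
    injective e -> (forall k, Y (e k)) ->
    radical (fun v => \sum_k e k (c k v)) -> forall k v, c k v \in N.

Lemma maximal_independent : exists Y, independent Y /\
  forall Y', Y `<` Y' -> ~ independent Y'.
Proof.
apply: Zorn_bigcup => F F_indep F_tot; split=> [al [Y FY Yal]|].
  by have [Y_st _] := F_indep _ FY; exact: Y_st.
case=> [|n] e c e_inj eF rad; first by case.
have [Y FY Ye] := chain_finite F_tot eF.
by have [_ Y_ind] := F_indep _ FY; exact: (Y_ind _ e).
Qed.

Lemma finite_stage n (al : 'I_n -> {linear U -> L}) :
    (forall k, stagewise (al k)) ->
  exists i, forall k, exists psi : {linear U -> M i},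
    forall v, l i (psi v) = al k v.
Proof.
have [[i0] dirI] := I_directed; have [l_cocone _] := L_limit.
elim: n => [|n IHn] in al *; first by exists i0; case.
move=> al_st; have [i iP] := IHn (fun k => al (lift ord0 k)) (fun k => al_st _).
have [j [psi psiE]] := al_st ord0; have [k [ik jk]] := dirI i j.
exists k => k'; have [k2 ->|->] := unliftP ord0 k'.
  have [psi' psi'E] := iP k2; exists (f ik \o psi') => v.
  by rewrite -psi'E -(l_cocone _ _ ik).
by exists (f jk \o psi) => v; rewrite -psiE -(l_cocone _ _ jk).
Qed.

Section Basis.
Variable Y : set {linear U -> L}.
Hypothesis Y_independent : independent Y.

Let b : {linear copower {al | Y al} U -> L} := colift sval.

Let b_coinj y v : b (coinj y v) = sval y v.
Proof. exact: colift_coinj. Qed.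

(** A relation among members of Y holds at some common stage. There the
    members are columns of maps into a copower of U, and a combination of these
    columns with entries in N lies in HJ after passing to the limit, because
    U is small; so the columns are independent. *)
Lemma independent_injective : injective b.
Proof.
apply: raddf_inj => z bz0; have [n [e [e_inj zE]]] := copower_decomp z.
pose al k := sval (e k).
have al_st k : stagewise (al k) by apply: Y_independent.1; exact: (svalP (e k)).
have [i /choice[psi psiE]] := finite_stage al_st.
have [|j [ij fz0]] := limit_zero I_directed f_system L_limit
    (m := \sum_k psi k (z (e k))).
  rewrite linear_sum -[RHS]bz0 [in RHS]zE [RHS]linear_sum; apply: eq_bigr => k _.
  by rewrite psiE b_coinj.
have [X [io [r rK]]] := Add_retract (AddM j).
pose th k : {linear U -> copower X U} := io \o (f ij \o psi k).
have thE k v : l j (r (th k v)) = al k v.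
  by rewrite /th /= rK -psiE; exact: L_limit.1.
have z0 : forall k, z (e k) = 0.
  apply: (@independent_mod_injective X n th); last first.
    by rewrite -[RHS](linear0 io) -fz0 !linear_sum.
  move=> c cN; apply: (Y_independent.2 n al c) => [k k'|k|].
  - move=> alkk'; apply: e_inj; apply: eq_sig_hprop alkk' => ? *.
    exact: Prop_irrelevance.
  - exact: (svalP (e k)).
  pose Th := linear_map (sum_of_linear
    (fun k => th k \o c k : {linear U -> copower X U})).
  have [m [e' ThE]] := fg_small Th U_fg.
  exists m, (fun t => l j \o (r \o coinj (e' t))), (fun t => coproj (e' t) \o Th).
  split=> [t|t v|v]; first by exists j, (r \o coinj (e' t)).
    exact: cN.
  rewrite -[RHS]/(\sum_t (l j \o r) (coinj (e' t) (Th v (e' t)))).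
  rewrite -linear_sum -ThE /Th /= !linear_sum; apply: eq_bigr => k _.
  exact/esym/thE.
by rewrite zE big1// => k _; rewrite z0 linear0.
Qed.

Hypothesis Y_maximal : forall Y', Y `<` Y' -> ~ independent Y'.

(** A stagewise map outside Y is dependent on Y; its coefficient in the
    dependence relation is not N-valued, hence can be inverted. *)
Lemma maximal_spans al : stagewise al ->
  exists2 rho, radical rho & forall v, exists w, al v = b w + rho v.
Proof.
move=> al_st; have [Yal|nYal] := pselect (Y al).
  exists (fun=> 0).
    exists 0%N, (fun=> \0), (fun=> \0); split=> [[]//|[]//|v].
    by rewrite big_ord0.
  by move=> v; exists (coinj (exist _ al Yal) v); rewrite b_coinj addr0.
have [Y_st Y_ind] := Y_independent.
have Y_lt : Y `<` (Y `|` [set al]).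
  by split=> [be Ybe|sub]; [left | apply: nYal; apply: sub; right].
have [n [e [c [e_inj eY rad [k [v cN]]]]]] : exists n
    (e : 'I_n -> {linear U -> L}) (c : 'I_n -> {linear U -> U}),
    [/\ injective e, forall k, (Y `|` [set al]) (e k),
        radical (fun v => \sum_k e k (c k v)) & exists k v, c k v \notin N].
  apply: contrapT => no; apply: (Y_maximal Y_lt); split.
    by move=> be [/Y_st//|->].
  move=> n e c e_inj eY rad k v; apply: contrapT => /negP cN; apply: no.
  by exists n, e, c; split=> //; exists k, v.
have [[k1 ek1]|no_al] := pselect (exists k, e k = al); last first.
  case/negP: cN; apply: (Y_ind _ e c) => // k'; have [//|ek'] := eY k'.
  by case: no_al; exists k'.
case: n => [|n] in e c e_inj eY rad k cN k1 ek1 *; first by have := ltn_ord k.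
have Ye j : Y (e (lift k1 j)).
  have [//|ej] := eY (lift k1 j).
  by have /e_inj/eqP := etrans ej (esym ek1); rewrite eq_sym (negPf (neq_lift _ _)).
have sumE w : \sum_k e k (c k w) =
    al (c k1 w) + \sum_j e (lift k1 j) (c (lift k1 j) w).
  by rewrite (bigD1_ord k1)//= ek1.
have [|g [cK gK]] := @N_local (c k1).
  move=> c1N; case/negP: cN.
  have cN j w : c (lift k1 j) w \in N.
    apply: (Y_ind _ (fun j => e (lift k1 j)) (fun j => c (lift k1 j))) => //.
      by move=> j1 j2 /e_inj/lift_inj.
    have -> : (fun v => \sum_k e (lift k1 k) (c (lift k1 k) v)) =
        (fun v => \sum_k e k (c k v) - al (c k1 v)).
      by apply/funext => w'; rewrite sumE addrAC subrr add0r.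
    exact: radical_sub_stagewise.
  by have [j ->|->] := unliftP k1 k.
exists (fun w => \sum_k e k (c k (g w))); first exact: (radical_comp g rad).
move=> w.
exists (- \sum_j coinj (exist _ _ (Ye j)) (c (lift k1 j) (g w))).
rewrite sumE gK linearN (linear_sum b) addrCA -[LHS]addr0; congr (_ + _).
apply/esym/eqP; rewrite addrC subr_eq0; apply/eqP.
by apply: eq_bigr => j _; rewrite b_coinj.
Qed.

(** Nakayama's lemma for a T-nilpotent radical: if al v misses the image of b,
    then by maximal_spans so does some ga (j v) with ga stagewise and j with
    image in N; the iteration of this step contradicts T-nilpotency. *)
Lemma maximal_surjective y : exists w, b w = y.
Proof.
pose im y := exists w, b w = y.
have imD y1 y2 : im y1 -> im y2 -> im (y1 + y2).
  by move=> [w1 <-] [w2 <-]; exists (w1 + w2); rewrite linearD.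
have im_sum n (F : 'I_n -> L) : (forall k, im (F k)) -> im (\sum_k F k).
  move=> imF; elim/big_rec: _ => [|k y' _ imy']; last exact: imD.
  by exists 0; rewrite linear0.
suff im_st al v : stagewise al -> im (al v).
  have [i [m <-]] := limit_element I_directed L_limit y.
  have [X [io [r rK]]] := Add_retract (AddM i).
  rewrite -(rK m); have [n [e [_ ->]]] := copower_decomp (io m).
  rewrite !linear_sum; apply: im_sum => k.
  by apply: (im_st (l i \o (r \o coinj (e k)))); exists i, (r \o coinj (e k)).
move=> al_st; apply: contrapT => no_im.
pose S := {s : {linear U -> L} * U | stagewise s.1 /\ ~ im (s.1 s.2)}.
have step (s : S) : exists s' : S, exists j : {linear U -> U},
    (forall v, j v \in N) /\ (sval s').2 = j (sval s).2.
  case: s => -[be x] [/= be_st no_imx].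
  have [rho [n [ga [j [ga_st jN rhoE]]]] bE] := maximal_spans be_st.
  have [k no_imk] : exists k, ~ im (ga k (j k x)).
    apply: contrapT => all_im; apply: no_imx; have [w ->] := bE x.
    rewrite rhoE; apply: imD; first by exists w.
    apply: im_sum => k; apply: contrapT => no_imk; apply: all_im.
    by exists k.
  by exists (exist _ (ga k, j k x) (conj (ga_st k) no_imk)), (j k).
have /choice[next /choice[j jP]] := step.
pose s n := iter n next (exist _ (al, v) (conj al_st no_im) : S).
have [|n|n sn0] := N_nilpotent (f := fun n => j (s n))
    (x := fun n => (sval (s n)).2).
- by move=> n w; exact: (jP (s n)).1.
- exact: (jP (s n)).2.
have [_] := svalP (s n); apply; rewrite sn0 linear0.
by exists 0; rewrite linear0.
Qed.

End Basis.

Lemma limit_in_Add : Add U L.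
Proof.
have [Y [Y_ind Y_max]] := maximal_independent.
apply: Add_of_bijection; apply: inj_surj_bijective.
  exact: (independent_injective Y_ind).
exact: (maximal_surjective Y_ind Y_max).
Qed.

End Limit.
End Bass.

(** * The theorem *)

Theorem corollary3p3 (R : pzRingType) (U : rmodType R)
    (U_fg : finitely_generated U) (U_uniserial : uniserial U)
    (covering_AddU : covering (Add U)) :
  closed_under_direct_limits (Add U).
Proof.
have [u u_gen] := fg_uniserial_cyclic U_fg U_uniserial.
move=> d I M f L l I_dir f_sys AddM L_lim.
have [u0|u_neq0] := eqVneq u 0.
  have U0 v : v = 0 :> U by have [a ->] := u_gen v; rewrite u0 scaler0.
  apply: (limit_in_Add (N := fun=> true)) I_dir f_sys AddM L_lim => //.
  by move=> h x _ _; exists 0%N; exact: U0.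
apply: (limit_in_Add (N := maximal_sub u)) I_dir f_sys AddM L_lim => //.
- exact: maximal_sub_closed.
- by move=> allN; case/negP: (gen_notin_maximal_sub u); exact: allN.
- move=> h hN; apply: (endo_invertible covering_AddU u_gen u_neq0 U_uniserial).
  apply/negP => hu; apply: hN; exact: into_maximal_sub.
- exact: (radical_endos_nilpotent U_fg covering_AddU u_gen).
Qed.
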